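(* There exists an open dense subset $\Omega$ of $(\mathbb{C}^{d\times d})^4$ such that for all quadruplets $(c_{-1},c_0,c_1,\alpha)\in\Omega$ (case $N=1$) and for every function $\mathbf{f}:\mathbb{R}\to\mathbb{C}^d$, the functional equation $$\alpha\,\mathbf{u}(t)+\sum_{k=-1}^{1}c_k\,\mathbf{u}(t+k\varepsilon)\,\chi(t+k\varepsilon)=\mathbf{f}(t)\qquad(t\in\mathbb{R})$$ admits one and only one solution $\mathbf{u}:\mathbb{R}\to\mathbb{C}^d$.
   Context: Here $d\ge1$, $[t_0,t_f]\subset\mathbb{R}$ is a fixed segment with characteristic function $\chi$, and $\varepsilon>0$ is a fixed time delay; it is assumed that the integer part $M$ of $\frac{t_f-t_0}{\varepsilon}$ satisfies $M\ge1$. The displayed equation is the equation $\alpha\mathbf{u}+\mathcal{C}\star(\chi\mathbf{u})=\mathbf{f}$, where $\mathcal{C}(t)=c_{-t/\varepsilon}$ if $t\in\varepsilon\mathbb{Z}$ and $\mathcal{C}(t)=0$ otherwise, $(\mathbf{u}\star\mathbf{v})(t)=\sum_{s\in\varepsilon\mathbb{Z}}\mathbf{u}(s)\mathbf{v}(t-s)$, in the case where $c_k=0$ for $|k|\ge2$; $N$ denotes the largest integer with $c_N\ne0$ or $c_{-N}\neq0$. No regularity is assumed on $\mathbf{u},\mathbf{f}$. *)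

(* Defs.v *)
From mathcomp Require Import all_boot all_order all_algebra.
From mathcomp Require Import all_classical all_reals all_analysis.
From mathcomp Require Export complex.
Import numFieldNormedType.Exports.

Set Implicit Arguments.
Unset Strict Implicit.
Unset Printing Implicit Defensive.

Import Order.TTheory GRing.Theory Num.Theory.

Local Open Scope ring_scope.
Local Open Scope classical_set_scope.

(* The complex numbers over [R]; the alias [^o] is the one that carries the
   normed-space topology, hence the topology on matrices and their products. *)
Notation Cplx R := ((complex R)^o).

Definition chi (R : realType) (t0 tf : R) : R -> Cplx R := \1_`[t0, tf].

(* alpha u + C * (chi u), where C t = c_(-t/eps) for t in eps Z and c_k = 0 for
   |k| >= 2; [cm1], [c0], [c1] stand for c_(-1), c_0, c_1. *)
Definition delay_op (R : realType) (d : nat) (t0 tf eps : R)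
    (cm1 c0 c1 alpha : 'M[Cplx R]_d) (u : R -> 'cV[Cplx R]_d) (t : R) :
    'cV[Cplx R]_d :=
  alpha *m u t
  + (chi t0 tf (t - eps) *: (cm1 *m u (t - eps))
     + chi t0 tf t *: (c0 *m u t)
     + chi t0 tf (t + eps) *: (c1 *m u (t + eps))).

(* Main.v *)
(* The equation only couples points of one orbit [s + eps Z], and only through
   the values of [u] at the finitely many orbit points lying in [t0, tf].
   Sampling at [n] consecutive orbit points therefore gives a square linear
   system, whose matrix depends affinely on the coefficients and, besides them,
   only on which of the [n] points lie in [t0, tf]. Omega is the locus where
   [det alpha] and the determinants attached to all the 2^n patterns are
   nonzero: a polynomial condition that holds at (0, 0, 0, 1), hence open and
   dense. Once [chi u] is known, [u] follows by inverting [alpha]. *)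
Require Import Defs.
From mathcomp Require Import all_boot all_order all_algebra.
From mathcomp Require Import all_classical all_reals all_analysis.
From mathcomp Require Import lra.
Import numFieldNormedType.Exports.
Import Order.TTheory GRing.Theory Num.Theory.
Local Open Scope ring_scope.
Local Open Scope classical_set_scope.

(** * Scalar functions that are polynomial along lines, and where they do not vanish *)

Section PolynomialFunctions.
Context {K : numFieldType} {V : normedModType K}.
Implicit Types f g : V -> K.

(** A coordinate-free substitute for polynomial functions: continuity makes the nonvanishing locus
    open, and polynomiality on each line makes it dense. *)
Definition polyfun f :=
  continuous f /\
  forall x v, exists p : {poly K}, forall s, f (x + s *: v) = p.[s].

Lemma polyfun_cst (c : K) : polyfun (fun=> c).
Proof.
split=> [|x v]; first exact: cst_continuous.
by exists c%:P => s; rewrite hornerC.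
Qed.

Lemma polyfunD f g :
  polyfun f -> polyfun g -> polyfun (fun x => f x + g x).
Proof.
move=> [cf pf] [cg pg]; split=> [x|x v]; first exact: continuousD (cf x) (cg x).
have [[p fp] [q gq]] := (pf x v, pg x v).
by exists (p + q) => s; rewrite hornerD fp gq.
Qed.

Lemma polyfunM f g :
  polyfun f -> polyfun g -> polyfun (fun x => f x * g x).
Proof.
move=> [cf pf] [cg pg]; split=> [x|x v]; first exact: continuousM (cf x) (cg x).
have [[p fp] [q gq]] := (pf x v, pg x v).
by exists (p * q) => s; rewrite hornerM fp gq.
Qed.

Lemma polyfun_sum (I : Type) (r : seq I) (P : pred I) (F : I -> V -> K) :
  (forall i, polyfun (F i)) -> polyfun (fun x => \sum_(i <- r | P i) F i x).
Proof.
move=> pF; elim: r => [|i r IHr].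
  by under eq_fun do rewrite big_nil; exact: polyfun_cst.
under eq_fun do rewrite big_cons.
by case: (P i); [exact: polyfunD | exact: IHr].
Qed.

Lemma polyfun_prod (I : Type) (r : seq I) (P : pred I) (F : I -> V -> K) :
  (forall i, polyfun (F i)) -> polyfun (fun x => \prod_(i <- r | P i) F i x).
Proof.
move=> pF; elim: r => [|i r IHr].
  by under eq_fun do rewrite big_nil; exact: polyfun_cst.
under eq_fun do rewrite big_cons.
by case: (P i); [exact: polyfunM | exact: IHr].
Qed.

Lemma polyfun_det n (A : V -> 'M[K]_n) :
  (forall i j, polyfun (fun x => A x i j)) -> polyfun (fun x => \det (A x)).
Proof.
move=> pA; apply: polyfun_sum => s; apply: polyfunM; first exact: polyfun_cst.
by apply: polyfun_prod => i; exact: pA.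
Qed.

Lemma open_polyfun_neq0 f : polyfun f -> open [set x | f x != 0].
Proof.
move=> [/continuousP cf _].
have -> : [set x | f x != 0] = f @^-1` (~` [set 0]).
  by apply/seteqP; split=> x /= /eqP.
apply/cf; rewrite openC; apply: accessible_closed_set1.
exact/hausdorff_accessible/norm_hausdorff.
Qed.

(** Supplies more small parameters than a given nonzero polynomial has roots. Denominators start at
    2 to keep the bound strict. *)
Lemma exists_small_seq (e : K) (n : nat) : 0 < e ->
  exists rs : seq K, [/\ size rs = n, uniq rs & all (fun s => `|s| < e) rs].
Proof.
move=> e0; exists [seq e / (i.+2)%:R | i <- iota 0 n]; split.
- by rewrite size_map size_iota.
- rewrite map_inj_uniq ?iota_uniq// => i j /(mulfI (lt0r_neq0 e0))/invr_inj.
  by move=> /eqP; rewrite eqr_nat => /eqP[].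
- apply/allP => _ /mapP[i _ ->].
  rewrite ger0_norm ?divr_ge0 ?ltW// ltr_pdivrMr ?ltr0n//.
  by rewrite ltr_pMr// ltr1n.
Qed.

(* A nonzero polynomial in one variable has finitely many roots, so moving from
   an arbitrary point towards [q] leaves the zero set immediately. *)
Lemma dense_polyfun_neq0 f q :
  polyfun f -> f q != 0 -> dense [set x | f x != 0].
Proof.
move=> [_ pf] fq O [x Ox] oO.
pose line (s : K) : V := x + s *: (q - x).
have [p fp] := pf x (q - x).
(* The line reaches [q] at parameter 1, so [p] takes the nonzero value [f q] there. *)
have p0 : p != 0.
  apply: contraNneq fq => p0; rewrite -[q](subrKC x) -[q - x]scale1r fp p0.
  by rewrite horner0.
have cline : continuous line.
  move=> s; apply: (@cvgD _ _ _ (nbhs s) _ (cst x) (fun r => r *: (q - x))).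
    exact: cvg_cst.
  exact: (@cvgZr_tmp _ _ _ (nbhs s) _ id).
have : nbhs (0 : K) (line @^-1` O).
  by apply: cline; apply: open_nbhs_nbhs; rewrite /line scale0r addr0.
move=> /nbhs_ballP[e /= e0 ballO].
have [rs [srs urs smallrs]] := exists_small_seq _ (size p) e0.
have /allPn[s srsP ps] : ~~ all (root p) rs.
  by apply/negP => /max_poly_roots-/(_ p0 urs); rewrite srs ltnn.
exists (line s); split; last by rewrite /= fp.
by apply: ballO; rewrite -ball_normE /= sub0r normrN (allP smallrs).
Qed.

End PolynomialFunctions.

Lemma continuous_fst (A B : topologicalType) : continuous (@fst A B).
Proof. by move=> [a b]; exact: cvg_fst. Qed.

Lemma continuous_snd (A B : topologicalType) : continuous (@snd A B).
Proof. by move=> [a b]; exact: cvg_snd. Qed.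

(** * The sampled finite linear system and its determinants *)

Section Window.
Context {K : numFieldType} {d n : nat}.
Implicit Types (b : {ffun 'I_n -> bool}) (U : 'M[K]_(d, n)).

(* Column [j] of [U *m shift_mx b k] is column [j + k] of [U] when that index is
   in range and selected by [b], and zero otherwise. *)
Definition shift_mx b (k : int) : 'M[K]_n :=
  \matrix_(i, j) (b i && (i%:Z == j%:Z + k))%:R.

Local Notation quadruple := ('M[K]_d * 'M[K]_d * 'M[K]_d * 'M[K]_d)%type.
Implicit Type x : quadruple.

(** The delay operator on [n] consecutive samples, stored as the columns of [U]; [b] stands for
    [chi], and [x] is [(cm1, c0, c1, alpha)]. *)
Definition window_op b x U : 'M[K]_(d, n) :=
  x.2 *m U + (x.1.1.1 *m (U *m shift_mx b (-1)) +
    x.1.1.2 *m (U *m shift_mx b 0) + x.1.2 *m (U *m shift_mx b 1)).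

Lemma col_window_op b x U j :
  col j (window_op b x U) = x.2 *m col j U +
    (x.1.1.1 *m col j (U *m shift_mx b (-1)) +
     x.1.1.2 *m col j (U *m shift_mx b 0) +
     x.1.2 *m col j (U *m shift_mx b 1)).
Proof. by rewrite /window_op !linearD /= !colE !mulmxA. Qed.

(** The matrix of [window_op b x] on vectorised samples. It acts on row vectors, so the left factor
    of each product, the shift, is applied first. *)
Definition window_mx b x : 'M[K]_(d * n) :=
  lin_mulmx x.2 + (lin_mulmxr (shift_mx b (-1)) *m lin_mulmx x.1.1.1 +
    lin_mulmxr (shift_mx b 0) *m lin_mulmx x.1.1.2 +
    lin_mulmxr (shift_mx b 1) *m lin_mulmx x.1.2).

Lemma mul_vec_window b x U : mxvec U *m window_mx b x = mxvec (window_op b x U).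
Proof. by rewrite !mulmxDr !mulmxA !mul_vec_lin /= -!raddfD. Qed.

Lemma window_mx1 b : window_mx b (0, 0, 0, 1%:M) = 1%:M.
Proof.
apply/row_matrixP => i; rewrite !rowE mulmx1 -[delta_mx _ _]vec_mxK.
by rewrite mul_vec_window /window_op /= !mul0mx mul1mx !addr0.
Qed.

Lemma polyfun_coef (c : quadruple -> 'M[K]_d) i j :
  continuous c -> (forall x v s, c (x + s *: v) = c x + s *: c v) ->
  polyfun (fun x => c x i j).
Proof.
move=> cc lc; split=> [x|x v].
  apply: (@continuous_comp _ _ _ c (fun A : 'M[K]_d => A i j)); first exact: cc.
  exact: (@coord_continuous K).
exists ((c x i j)%:P + 'X * (c v i j)%:P) => s.
by rewrite lc !mxE !hornerE.
Qed.

Lemma polyfun_coef_mulmx (c : quadruple -> 'M[K]_d) U i j :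
  (forall i j, polyfun (fun x => c x i j)) ->
  polyfun (fun x => (c x *m U) i j).
Proof.
move=> pc; under eq_fun do rewrite mxE.
by apply: polyfun_sum => k; apply: polyfunM; [exact: pc | exact: polyfun_cst].
Qed.

Lemma polyfun_cm1 i j : polyfun (fun x => x.1.1.1 i j).
Proof.
apply: (polyfun_coef (fun x => x.1.1.1)) => // x.
apply: (@continuous_comp _ _ _ (fun y : quadruple => y.1.1) fst).
  apply: (@continuous_comp _ _ _ (fun y : quadruple => y.1) fst).
    exact: continuous_fst.
  exact: continuous_fst.
exact: continuous_fst.
Qed.

Lemma polyfun_c0 i j : polyfun (fun x => x.1.1.2 i j).
Proof.
apply: (polyfun_coef (fun x => x.1.1.2)) => // x.
apply: (@continuous_comp _ _ _ (fun y : quadruple => y.1.1) snd).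
  apply: (@continuous_comp _ _ _ (fun y : quadruple => y.1) fst).
    exact: continuous_fst.
  exact: continuous_fst.
exact: continuous_snd.
Qed.

Lemma polyfun_c1 i j : polyfun (fun x => x.1.2 i j).
Proof.
apply: (polyfun_coef (fun x => x.1.2)) => // x.
apply: (@continuous_comp _ _ _ (fun y : quadruple => y.1) snd).
  exact: continuous_fst.
exact: continuous_snd.
Qed.

Lemma polyfun_alpha i j : polyfun (fun x => x.2 i j).
Proof. by apply: (polyfun_coef snd) => // x; exact: continuous_snd. Qed.

(** Row [i] is the image of the [i]-th basis vector, so each entry is an entry of [window_op] at a
    constant [U], which is linear in the coefficients. *)
Lemma polyfun_window_mx b i j : polyfun (fun x => window_mx b x i j).
Proof.
have window_row x k : window_mx b x i k =
    mxvec (window_op b x (vec_mx (delta_mx 0 i))) 0 k.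
  by rewrite -mul_vec_window vec_mxK -rowE [RHS]mxE.
under eq_fun do rewrite window_row.
case/mxvec_indexP: j => r m; set U := vec_mx _.
have addE (A B : 'M[K]_(d, n)) : (A + B) r m = A r m + B r m by rewrite mxE.
under eq_fun do rewrite mxvecE !addE.
do ?[apply: polyfunD].
- exact: polyfun_coef_mulmx polyfun_alpha.
- exact: polyfun_coef_mulmx polyfun_cm1.
- exact: polyfun_coef_mulmx polyfun_c0.
- exact: polyfun_coef_mulmx polyfun_c1.
Qed.

(** Taking one product over all patterns lets openness and density follow from a single polynomial
    function. *)
Definition window_det x : K := \det x.2 * \prod_b \det (window_mx b x).

Lemma polyfun_window_det : polyfun window_det.
Proof.
apply: polyfunM; first by apply: polyfun_det; exact: polyfun_alpha.
by apply: polyfun_prod => b; apply: polyfun_det; exact: polyfun_window_mx.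
Qed.

Lemma window_det1 : window_det (0, 0, 0, 1%:M) != 0.
Proof.
rewrite /window_det det1 mul1r big1 ?oner_eq0// => b _.
by rewrite window_mx1 det1.
Qed.

Lemma window_det_unit x : window_det x != 0 ->
  (x.2 \in unitmx) /\ forall b, window_mx b x \in unitmx.
Proof.
rewrite mulf_eq0 negb_or => /andP[ua /prodf_neq0 uw].
by split=> [|b]; rewrite unitmxE unitfE// uw.
Qed.

Lemma window_op_bij b x : window_det x != 0 -> bijective (window_op b x).
Proof.
move=> /window_det_unit[_ /(_ b) uw].
exists (fun F => vec_mx (mxvec F *m invmx (window_mx b x))) => [U|F].
  by rewrite -mul_vec_window mulmxK// mxvecK.
by apply: (can_inj mxvecK); rewrite -mul_vec_window vec_mxK mulmxKV.
Qed.

End Window.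

(** * From the sampled systems back to functions on the real line *)

Section Orbits.
Context {R : realType} {K : numFieldType} {d n : nat} {t0 tf eps : R}.
Context (eps_gt0 : 0 < eps).
Context (n_large : tf - t0 < n%:R * eps).
Implicit Types (g u v f : R -> 'cV[K]_d) (s t : R).

Let chi t : K := (t0 <= t <= tf)%R%:R.

Definition pattern s : {ffun 'I_n -> bool} :=
  [ffun i : 'I_n => t0 <= s + i%:R * eps <= tf].

Definition samples g s : 'M[K]_(d, n) :=
  \matrix_(r, i) g (s + i%:R * eps) r 0.

(** Each orbit is represented by its only point in [[t0, t0 + eps)]; the index counts the steps of
    [eps] from there to [t]. *)
Definition orbit_index t : int := Num.floor ((t - t0) / eps).
Definition orbit_base t : R := t - (orbit_index t)%:~R * eps.

Lemma orbit_base_itv t : t0 <= orbit_base t < t0 + eps.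
Proof.
rewrite /orbit_base /orbit_index.
have /andP[] := floor_itv ((t - t0) / eps).
rewrite ler_pdivlMr// ltr_pdivrMr// intrD mulr1z [(_ + 1) * _]mulrDl mul1r.
by move=> le_t lt_t; apply/andP; split; lra.
Qed.

Lemma orbit_baseK t : orbit_base t + (orbit_index t)%:~R * eps = t.
Proof. by rewrite subrK. Qed.

Lemma orbit_index_shift s (k : int) :
  t0 <= s < t0 + eps -> orbit_index (s + k%:~R * eps) = k.
Proof.
move=> /andP[le_s lt_s]; apply: floor_def.
rewrite ler_pdivlMr// ltr_pdivrMr// intrD mulr1z mulrDl mul1r.
by apply/andP; split; lra.
Qed.

Lemma orbit_base_shift s (k : int) :
  t0 <= s < t0 + eps -> orbit_base (s + k%:~R * eps) = s.
Proof. by move=> s_itv; rewrite /orbit_base orbit_index_shift// addrK. Qed.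

(** A negative index falls below [t0], and an index of at least [n] goes beyond [tf] by [n_large]:
    the window contains all orbit points of the segment. *)
Lemma orbit_index_ord s (k : int) : t0 <= s < t0 + eps ->
  t0 <= s + k%:~R * eps <= tf -> exists i : 'I_n, k = i%:Z.
Proof.
move=> /andP[le_s lt_s] /andP[le_k ge_k].
have k_gt : (-1)%:~R * eps < k%:~R * eps by rewrite mulrNz mulr1z mulN1r; lra.
have k_lt : k%:~R * eps < n%:~R * eps.
  by rewrite -pmulrn; apply: le_lt_trans n_large; lra.
rewrite !ltr_pM2r// !ltr_int in k_gt k_lt.
case: k k_gt k_lt {le_k ge_k} => // k _; rewrite ltz_nat => kn.
by exists (Ordinal kn).
Qed.

(** Truncating the orbit to the window loses nothing: when [j + k] leaves the range, [t] lies
    outside the segment and both sides vanish. *)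
Lemma col_samples_shift g s (k : int) (j : 'I_n) t :
  t0 <= s < t0 + eps -> t = s + (j%:Z + k)%:~R * eps ->
  col j (samples g s *m shift_mx (pattern s) k) = chi t *: g t.
Proof.
move=> s_itv tE; apply/colP => r; rewrite !mxE /chi.
under eq_bigr do rewrite !mxE ffunE.
have [t_in|t_out] := boolP (t0 <= t <= tf).
  have [i ki] : exists i : 'I_n, j%:Z + k = i%:Z.
    by apply: orbit_index_ord s_itv _; rewrite -tE.
  have {}tE : t = s + i%:R * eps by rewrite tE ki -pmulrn.
  rewrite ki (bigD1 i)//= -tE t_in eqxx mulr1 mul1r big1 ?addr0// => l li.
  by rewrite eqz_nat (inj_eq val_inj) (negPf li) andbF mulr0.
rewrite mul0r big1// => i _; case: eqP => [ik|_]; last by rewrite andbF mulr0.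
by rewrite pmulrn ik -tE (negPf t_out) mulr0.
Qed.

Context {cm1 c0 c1 alpha : 'M[K]_d}.
Local Notation window := (fun s => window_op (pattern s) (cm1, c0, c1, alpha)).

(** With [chi] attached to [g], these terms visibly depend on [g] only through [chi g]. *)
Definition delayed_terms g t : 'cV[K]_d :=
  cm1 *m (chi (t - eps) *: g (t - eps)) + c0 *m (chi t *: g t) +
  c1 *m (chi (t + eps) *: g (t + eps)).

Definition delay_fun g t : 'cV[K]_d := alpha *m g t + delayed_terms g t.

(** The shifts erase the columns outside the pattern, so agreement is required only on the selected
    ones. Surjectivity needs this generality: there, the other columns of [U] need not be values of
    [w]. *)
Lemma col_window_op_orbit g s U j : t0 <= s < t0 + eps ->
  (forall i, pattern s i -> col i U = g (s + i%:R * eps)) ->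
  col j (window s U) = alpha *m col j U + delayed_terms g (s + j%:R * eps).
Proof.
move=> s_itv Ug.
have shiftU k :
    U *m shift_mx (pattern s) k = samples g s *m shift_mx (pattern s) k.
  apply/matrixP => r i; rewrite !mxE; apply: eq_bigr => l _; rewrite !mxE.
  case: (boolP (pattern s l)) => [/Ug <-|_]; first by rewrite mxE.
  by rewrite !mulr0.
rewrite col_window_op !shiftU /delayed_terms /=.
set t := s + _.
rewrite (col_samples_shift _ _ (-1) _ (t - eps) s_itv); last first.
  by rewrite intrD mulrNz mulr1z -pmulrn mulrDl mulN1r addrA.
rewrite (col_samples_shift _ _ 0 _ t s_itv) ?addr0 -?pmulrn//.
rewrite (col_samples_shift _ _ 1 _ (t + eps) s_itv)//.
by rewrite intrD mulr1z -pmulrn mulrDl mul1r addrA.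
Qed.

Lemma samples_delay_fun g s : t0 <= s < t0 + eps ->
  samples (delay_fun g) s = window s (samples g s).
Proof.
move=> s_itv; apply/matrixP => r i; rewrite mxE /delay_fun.
have colg j : col j (samples g s) = g (s + j%:R * eps).
  by apply/colP => q; rewrite !mxE.
have /colP/(_ r) := col_window_op_orbit _ _ _ i s_itv (fun j _ => colg j).
by rewrite mxE colg => ->.
Qed.

Context (det_neq0 : window_det (n := n) (cm1, c0, c1, alpha) != 0).

Lemma delay_fun_inj u v : (forall t, delay_fun u t = delay_fun v t) -> u = v.
Proof.
move=> uv.
have samples_eq s : t0 <= s < t0 + eps -> samples u s = samples v s.
  move=> s_itv; apply: (bij_inj (window_op_bij (pattern s) _ det_neq0)).
  by rewrite -!samples_delay_fun//; congr (samples _ s); exact/funext.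
have chi_eq t : chi t *: u t = chi t *: v t.
  rewrite /chi; have [t_in|] := boolP (_ <= _ <= _); last by rewrite !scale0r.
  have base := orbit_base_itv t.
  rewrite -{1 2}(orbit_baseK t) in t_in.
  have [i ti] := orbit_index_ord _ _ base t_in.
  have /matrixP eq_i := samples_eq _ base.
  congr (_ *: _); apply/colP => r; have := eq_i r i.
  by rewrite !mxE pmulrn -ti orbit_baseK.
have [alpha_unit _] := window_det_unit _ det_neq0.
apply/funext => t; have := uv t.
(* Since [chi u] and [chi v] agree, the delayed terms cancel and only the [alpha] terms remain. *)
rewrite !/delay_fun /delayed_terms !chi_eq => /addIr.
by move=> /(congr1 (mulmx (invmx alpha))); rewrite !mulKmx.
Qed.

Lemma delay_fun_surj f : exists u, forall t, delay_fun u t = f t.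
Proof.
have [alpha_unit _] := window_det_unit _ det_neq0.
have /choice[U UE] s : exists U, window s U = samples f s.
  have [inv _ invK] := window_op_bij (pattern s) _ det_neq0.
  by exists (inv (samples f s)).
(* [w] plays the role of [chi u]. *)
pose w t : 'cV[K]_d := \sum_(i < n)
  (pattern (orbit_base t) i && (orbit_index t == i%:Z))%:R *:
    col i (U (orbit_base t)).
have w_orbit s i : t0 <= s < t0 + eps -> pattern s i ->
    col i (U s) = w (s + i%:R * eps).
  move=> s_itv si; rewrite /w pmulrn orbit_base_shift// orbit_index_shift//.
  rewrite (bigD1 i)//= si eqxx scale1r big1 ?addr0// => l li.
  by rewrite eqz_nat eq_sym (inj_eq val_inj) (negPf li) andbF scale0r.
(* The equation solved for its undelayed term, with [w] in place of [chi u]. *)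
pose u t := invmx alpha *m (f t - delayed_terms w t).
(* Consistency of this substitution: inside the segment, the window system says that [w t] satisfies
   the same relation that defines [u t]. *)
have chi_u t : chi t *: u t = chi t *: w t.
  rewrite /chi; have [t_in|] := boolP (_ <= _ <= _); last by rewrite !scale0r.
  have base := orbit_base_itv t.
  have [i ti] : exists i : 'I_n, orbit_index t = i%:Z.
    by apply: (orbit_index_ord _ _ base); rewrite orbit_baseK.
  have tE : orbit_base t + i%:R * eps = t by rewrite pmulrn -ti orbit_baseK.
  have := col_window_op_orbit _ _ _ i base (fun l => w_orbit _ l base).
  rewrite UE tE => col_i.
  have {col_i} fE : f t = alpha *m col i (U (orbit_base t)) + delayed_terms w t.
    by rewrite -col_i; apply/colP => r; rewrite !mxE tE.
  by rewrite /u fE addrK mulKmx// w_orbit ?ffunE ?tE.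
exists u => t.
by rewrite /delay_fun /delayed_terms !chi_u mulKVmx// subrK.
Qed.

End Orbits.

Lemma delay_opE (R : realType) d (t0 tf eps : R)
    (cm1 c0 c1 alpha : 'M[Cplx R]_d) (u : R -> 'cV[Cplx R]_d) t :
  delay_op t0 tf eps cm1 c0 c1 alpha u t =
  @delay_fun R (Cplx R) d t0 tf eps cm1 c0 c1 alpha u t.
Proof.
have chiE s : chi t0 tf s = (t0 <= s <= tf)%R%:R.
  by rewrite /chi indicE mem_setE in_itv.
by rewrite /delay_op !chiE !scalemxAr.
Qed.

Theorem theorem5p1 (R : realType) (d : nat) (t0 tf eps : R)
  (hd : (1 <= d)%N) (heps : 0 < eps) (ht : t0 < tf)
  (hM : 1 <= Num.floor ((tf - t0) / eps)) :
  exists Omega : set ('M[Cplx R]_d * 'M[Cplx R]_d * 'M[Cplx R]_d * 'M[Cplx R]_d),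
    [/\ open Omega, dense Omega &
      forall cm1 c0 c1 alpha : 'M[Cplx R]_d, Omega (cm1, c0, c1, alpha) ->
      forall f : R -> 'cV[Cplx R]_d,
      exists! u : R -> 'cV[Cplx R]_d,
        forall t : R, delay_op t0 tf eps cm1 c0 c1 alpha u t = f t].
Proof.
(* One strict upper bound for the ratio serves all orbits: [n] steps from any point at or after [t0]
   pass [tf]. *)
pose n := Num.bound ((tf - t0) / eps).
have n_large : tf - t0 < n%:R * eps.
  by rewrite -ltr_pdivrMr// archi_boundP// divr_ge0 ?subr_ge0 ?ltW.
exists [set x | window_det (n := n) x != 0]; split.
- exact: open_polyfun_neq0 _ polyfun_window_det.
- exact: dense_polyfun_neq0 _ _ polyfun_window_det window_det1.
- move=> cm1 c0 c1 alpha det_neq0 f.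
  have [u uf] := delay_fun_surj heps n_large det_neq0 f.
  exists u; split=> [t|v vf]; first by rewrite delay_opE.
  apply: (delay_fun_inj heps n_large det_neq0) => t.
  by rewrite uf -vf delay_opE.
Qed.
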